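(* For S-D pairs $x_d^{(n)},x_s^{(n)}\in\partial\Omega$, $n=1,2$, write $t_{peak}^{a,(n)}:=t_{peak}^a(x_d^{(n)},x_s^{(n)};x_c)$ and $\lambda^{(n)}:=\lambda(x_d^{(n)},x_s^{(n)};x_c)$. Then $$t_{peak}^{a,(1)}\ge t_{peak}^{a,(2)}\iff\lambda^{(1)}\ge\lambda^{(2)} .$$ If the S-D pairs are assumed to satisfy $$|x_d^{(1)}-x_s^{(1)}|=|x_d^{(2)}-x_s^{(2)}|,$$ then $t_{peak}^{a,(2)}$ (as a function of the pair $x_d^{(2)},x_s^{(2)}$ subject to this constraint) attains its unique minimum when $x_d^{(2)}$ and $x_s^{(2)}$ satisfy $$x_{c_1}=\frac{x_{d_1}^{(2)}+x_{s_1}^{(2)}}{2},\qquad x_{c_2}=\frac{x_{d_2}^{(2)}+x_{s_2}^{(2)}}{2}.$$ If the S-D pairs are further assumed to satisfy $$x_{s_1}^{(1)}-x_{s_1}^{(2)}=x_{d_1}^{(1)}-x_{d_1}^{(2)},\quad x_{s_2}^{(1)}=x_{s_2}^{(2)},\quad x_{d_2}^{(1)}=x_{d_2}^{(2)},$$ then $t_{peak}^{a,(1)}=t_{peak}^{a,(2)}$ implies $$x_{c_1}=\frac{x_{s_1}^{(1)}+x_{d_1}^{(2)}}{2}.$$ Similarly, if $$x_{s_2}^{(1)}-x_{s_2}^{(2)}=x_{d_2}^{(1)}-x_{d_2}^{(2)},\quad x_{s_1}^{(1)}=x_{s_1}^{(2)},\quad x_{d_1}^{(1)}=x_{d_1}^{(2)},$$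 then $t_{peak}^{a,(1)}=t_{peak}^{a,(2)}$ implies $$x_{c_2}=\frac{x_{s_2}^{(1)}+x_{d_2}^{(2)}}{2}.$$
   Context: Setting: $\Omega=\{x\in\mathbb{R}^3:x_3>0\}$, $\partial\Omega=\{x_3=0\}$; $x_c=(x_{c_1},x_{c_2},x_{c_3})\in\Omega$ is a fixed target point. An S-D pair consists of a detector point $x_d\in\partial\Omega$ and a source point $x_s\in\partial\Omega$; $x_{d_j}^{(n)},x_{s_j}^{(n)}$ denote the $j$-th coordinates of $x_d^{(n)},x_s^{(n)}$. The constants $v,D,\mu_a,\ell$ are positive, $k:=\mu_a v$, and $$\lambda=\lambda(x_d,x_s;x_c):=\left(\frac{|x_d-x_c|^2+|x_s-x_c|^2}{2vD}\right)^{1/2}.$$ Define $$P(t;\lambda):=\lambda e^{-\frac{(\sqrt{k}\,t-\lambda)^2}{t}}-\pi^{\frac12}\ell^{-1}t^{\frac32},\qquad t>\lambda k^{-\frac12}.$$ The approximate peak time $t_{peak}^a(x_d,x_s;x_c)$ is the unique root $t>\lambda k^{-1/2}$ of $P(t;\lambda)=0$ with $\lambda=\lambda(x_d,x_s;x_c)$. Standing assumption: $\ell>\pi^{1/2}k^{-3/4}\lambda^{1/2}$ for every S-D pair considered, which guarantees that this root exists and is unique.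
   Formalization: In the last two claims the two S-D pairs are assumed to be different; if they coincide, all hypotheses and the equality of peak times hold trivially while the midpoint formula can fail (e.g. x_d=x_s=(1,0,0), x_c=(0,0,1), ℓ large). *)

(* Defs.v *)
From mathcomp Require Import all_boot all_order all_algebra.
From mathcomp Require Import all_classical all_reals all_analysis.

Set Implicit Arguments.
Unset Strict Implicit.
Unset Printing Implicit Defensive.

Import Order.TTheory GRing.Theory Num.Theory.
Local Open Scope classical_set_scope.
Local Open Scope ring_scope.

(* Points of R^3 are row vectors; the coordinates x_1, x_2, x_3 of x are
   x 0 0, x 0 1, x 0 2. *)

(* The norm `|_| that the library puts on 'rV[R]_3 is the sup norm, hence a
   separate Euclidean distance. *)
Definition eucl_dist (R : realType) (x y : 'rV[R]_3) : R :=
  Num.sqrt (\sum_(i < 3) (x 0 i - y 0 i) ^+ 2).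

Definition halfspace (R : realType) : set 'rV[R]_3 := [set x | 0 < x 0 2].

Definition halfspace_bd (R : realType) : set 'rV[R]_3 := [set x | x 0 2 = 0].

Definition lambda (R : realType) (v D : R) (xc xd xs : 'rV[R]_3) : R :=
  Num.sqrt ((eucl_dist xd xc ^+ 2 + eucl_dist xs xc ^+ 2) / (2 * v * D)).

Definition peakP (R : realType) (k ell lam t : R) : R :=
  lam * expR (- ((Num.sqrt k * t - lam) ^+ 2 / t))
  - Num.sqrt pi * ell^-1 * t `^ (3 / 2).

Definition peak_root (R : realType) (k ell lam : R) : set R :=
  [set t | lam * (Num.sqrt k)^-1 < t /\ peakP k ell lam t = 0].

(* The element of [peak_root], which is a singleton under the inequality in
   [sd_pair]; the default value 0 is irrelevant there. *)
Definition tpeak (R : realType) (v D mu_a ell : R) (xc xd xs : 'rV[R]_3) : R :=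
  xget 0 (peak_root (mu_a * v) ell (lambda v D xc xd xs)).

(* The pairs (x_d, x_s) of boundary points for which the standing assumption
   ell > pi^(1/2) k^(-3/4) lambda^(1/2), with k = mu_a v, holds. *)
Definition sd_pair (R : realType) (v D mu_a ell : R) (xc : 'rV[R]_3) :
    set ('rV[R]_3 * 'rV[R]_3) :=
  [set p | [/\ halfspace_bd p.1, halfspace_bd p.2 &
     Num.sqrt pi * (mu_a * v) `^ (- (3 / 4))
       * Num.sqrt (lambda v D xc p.1 p.2) < ell]].

Definition is_minimizer (R : realType) (T : Type) (S : set T) (f : T -> R)
    (x : T) : Prop :=
  S x /\ forall y, S y -> f x <= f y.

(* Main.v *)
Require Import Defs.
From mathcomp Require Import all_boot all_order all_algebra.
From mathcomp Require Import all_classical all_reals all_analysis.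
From mathcomp Require Import ring lra.

Import Order.TTheory GRing.Theory Num.Theory.
Import numFieldNormedType.Exports.
Local Open Scope classical_set_scope.
Local Open Scope ring_scope.

(* On [t >= lam k^(-1/2)] the function [peakP] is strictly decreasing in [t],
   and at fixed [t] it is strictly increasing in [lam] as long as
   [lam <= sqrt k t]. Hence the peak time is strictly increasing in [lam], and
   comparing peak times amounts to comparing |x_d - x_c|^2 + |x_s - x_c|^2. By
   the parallelogram identity this is twice the squared distance from x_c to
   the midpoint of the pair plus half the squared separation, which settles the
   minimization; for a pair translated along one axis, equality of the two sums
   is a linear equation in that coordinate of x_c. *)

Lemma powR_3half (R : realType) (t : R) :
  0 <= t -> t `^ (3 / 2) = t * Num.sqrt t.
Proof.
rewrite le_eqVlt => /predU1P[<-|t0]; first by rewrite powR0 ?mul0r//; lra.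
have -> : 3 / 2 = 1 + 2^-1 :> R by lra.
by rewrite powRD ?(gt_eqF t0) ?implybT// powRr1 ?powR12_sqrt// ltW.
Qed.

Lemma powR_N3quarter (R : realType) (k : R) : 0 <= k ->
  k `^ (- (3 / 4)) = (Num.sqrt k * Num.sqrt (Num.sqrt k))^-1.
Proof.
move=> k0; rewrite powRN -powR_3half ?sqrtr_ge0// -powR12_sqrt// -powRrM.
by congr (_ `^ _)^-1; field.
Qed.

(** * Roots of the peak equation and their dependence on [lam] *)

Section peak_root_theory.
Context {R : realType} {k ell : R} (k0 : 0 < k) (ell0 : 0 < ell).

Let s := Num.sqrt k.
Let s0 : 0 < s. Proof. by rewrite sqrtr_gt0. Qed.
Let c := Num.sqrt pi * ell^-1 : R.
Let c0 : 0 < c. Proof. by rewrite mulr_gt0 ?invr_gt0// sqrtr_gt0 pi_gt0. Qed.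

Let peakPE lam t : 0 <= t -> peakP k ell lam t =
  lam * expR (- ((s * t - lam) ^+ 2 / t)) - c * (t * Num.sqrt t).
Proof. by move=> t0; rewrite /peakP powR_3half. Qed.

(** After cross-multiplication, the change of [(s * t - lam) ^+ 2 / t] from [t1] to [t2] factors as
    [(t2 - t1) * (s ^+ 2 * t1 * t2 - lam ^+ 2)], which is nonnegative beyond [lam / s]. Strictness
    comes from the term in [t * Num.sqrt t]. *)
Lemma peakP_decreasing {lam t1 t2} : 0 < lam -> lam / s <= t1 -> t1 < t2 ->
  peakP k ell lam t2 < peakP k ell lam t1.
Proof.
move=> lam0 h t12.
have t10 : 0 < t1 by apply: lt_le_trans h; rewrite divr_gt0.
have t20 : 0 < t2 by apply: lt_trans t12.
rewrite !peakPE ?ltW// ler_ltB//.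
  rewrite ler_pM2l// ler_expR lerN2 ler_pdivrMr// mulrAC ler_pdivlMr//.
  rewrite ler_pdivrMr// mulrC in h.
  rewrite -subr_ge0.
  have -> : (s * t2 - lam) ^+ 2 * t1 - (s * t1 - lam) ^+ 2 * t2 =
    (t2 - t1) * ((s * t1) * (s * t2) - lam * lam) by ring.
  apply: mulr_ge0; rewrite subr_ge0; first exact: ltW.
  by rewrite ler_pM ?(ltW lam0)// (le_trans h)// ler_pM2l// ltW.
by rewrite ltr_pM2l// ltr_pM ?sqrtr_ge0 ?ltr_sqrt// ltW.
Qed.

Lemma peakP_increasing_lam {lam1 lam2 t} :
  0 < lam1 -> lam1 < lam2 -> lam2 / s <= t ->
  peakP k ell lam1 t < peakP k ell lam2 t.
Proof.
move=> lam10 lam12 h.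
have lam20 := lt_trans lam10 lam12.
have t0 : 0 < t by apply: lt_le_trans h; rewrite divr_gt0.
rewrite !peakPE ?ltW// ltrD2r.
rewrite ler_pdivrMr// mulrC in h.
rewrite ltr_pM ?ltW ?expR_gt0// ltr_expR ltrN2 ltr_pM2r ?invr_gt0//.
by rewrite ltr_pXn2r// ?nnegrE; lra.
Qed.

Lemma peak_root_exists {lam} : 0 < lam ->
  Num.sqrt pi * k `^ (- (3 / 4)) * Num.sqrt lam < ell ->
  peak_root k ell lam !=set0.
Proof.
move=> lam0 h.
pose a := lam / s.
have a0 : 0 < a by rewrite divr_gt0.
(* Since [1 <= b] and [lam / c < b], the subtracted term [c * (b * Num.sqrt b)] exceeds [lam], which
   bounds the exponential term. *)
pose b := Num.max (a + 1) (lam / c + 1).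
pose f t : R := lam * expR (- ((s * t - lam) ^+ 2 / t)) - c * (t * Num.sqrt t).
(* The exponent vanishes at [a], and [c * (a * Num.sqrt a) < lam] is a rearrangement of the standing
   assumption. *)
have fa : 0 < f a.
  rewrite /f [s * a]mulrC divfK ?gt_eqF// subrr expr0n/= mul0r oppr0 expR0.
  rewrite mulr1 subr_gt0 /a /c sqrtrM ?ltW// sqrtrV ?ltW//.
  rewrite powR_N3quarter ?ltW// in h.
  have ss0 : 0 < Num.sqrt s by rewrite sqrtr_gt0.
  rewrite -/s -(ltr_pM2r lam0) -ltr_pdivrMl// in h.
  apply: le_lt_trans h; rewrite le_eqVlt; apply/orP; left; apply/eqP.
  by field; rewrite !gt_eqF.
have lc0 : 0 < lam / c by rewrite divr_gt0.
have ab : a < b by rewrite lt_max ltrDl ltr01.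
have b1 : 1 <= b by rewrite le_max; apply/orP; right; lra.
have b0 : 0 < b by exact: lt_le_trans b1.
have fb : f b < 0.
  rewrite subr_lt0 (@le_lt_trans _ _ lam)//.
    by rewrite ger_pMr// expR_le1 oppr_le0 divr_ge0 ?sqr_ge0// ltW.
  rewrite mulrC -ltr_pdivrMr// (@lt_le_trans _ _ b)//.
    by rewrite lt_max; apply/orP; right; lra.
  by rewrite ler_peMr ?(ltW b0)// -sqrtr1 ler_sqrt// ltW.
have fab : Num.min (f a) (f b) <= 0 <= Num.max (f a) (f b).
  by rewrite ge_min (ltW fb) orbT le_max (ltW fa).
have fC : {within `[a, b], continuous f}.
  apply: continuous_in_subspaceT => t; rewrite inE/= in_itv/= => /andP[at_ _].
  have t0 : t != 0 by rewrite gt_eqF// (lt_le_trans a0).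
  apply: cvgB; apply: cvgM; try exact: cvg_cst.
    apply: continuous_comp; last exact: continuous_expR.
    apply: cvgN; apply: cvgM; last exact: cvgV.
    apply: (@continuous_comp _ _ _ (fun x => s * x - lam) (fun x => x ^+ 2)).
      by apply: cvgB; [apply: cvgM => //; exact: cvg_cst|exact: cvg_cst].
    exact: exprn_continuous.
  by apply: cvgM => //; exact: sqrt_continuous.
have [t] := IVT (ltW ab) fC fab; rewrite in_itv/= => /andP[at_ tb] ft.
have at' : a < t.
  by rewrite lt_neqAle at_ andbT; apply: contraTneq fa => ->; rewrite ft ltxx.
by exists t; split=> //; rewrite peakPE// ltW// (lt_trans a0).
Qed.

(** If [t1 <= lam2 / s], then [t2] lies beyond it by definition. Otherwise [t2 <= t1] would make
    [peakP] at [lam2], [t1] at most 0 by monotonicity in [t], yet positive by monotonicity in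
    [lam]. *)
Lemma peak_root_lt {lam1 lam2 t1 t2} : 0 < lam1 -> lam1 < lam2 ->
  peak_root k ell lam1 t1 -> peak_root k ell lam2 t2 -> t1 < t2.
Proof.
move=> lam10 lam12 [h1 p1] [h2 p2].
have [/le_lt_trans->//|h] := leP t1 (lam2 / s).
rewrite ltNge; apply/negP => t21.
have lam20 := lt_trans lam10 lam12.
have : peakP k ell lam2 t1 <= peakP k ell lam2 t2.
  move: t21; rewrite le_eqVlt => /predU1P[->//|t21].
  exact/ltW/peakP_decreasing/t21/ltW.
by rewrite p2 leNgt -p1 (peakP_increasing_lam lam10 lam12 (ltW h)).
Qed.

End peak_root_theory.

(** * From peak times to distances *)

Section tpeak_lambda.
Context {R : realType} {v D mu_a ell : R} {xc : 'rV[R]_3}.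
Context (hv : 0 < v) (hD : 0 < D) (hmu : 0 < mu_a) (hell : 0 < ell).
Context (hxc : halfspace xc).
Local Notation tp := (tpeak v D mu_a ell xc).
Local Notation lam := (lambda v D xc).

Lemma eucl_distE (x y : 'rV[R]_3) : eucl_dist x y ^+ 2 =
  (x 0 0 - y 0 0) ^+ 2 + (x 0 1 - y 0 1) ^+ 2 + (x 0 2 - y 0 2) ^+ 2.
Proof.
rewrite sqr_sqrtr; last by apply: sumr_ge0 => i _; exact: sqr_ge0.
rewrite !big_ord_recl big_ord0 addr0 addrA.
by do 3?congr (_ + _); congr ((x 0 _ - y 0 _) ^+ 2); exact: val_inj.
Qed.

(* The parallelogram identity. *)
Lemma dist_midpoint (xd xs : 'rV[R]_3) :
  halfspace_bd xd -> halfspace_bd xs ->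
  eucl_dist xd xc ^+ 2 + eucl_dist xs xc ^+ 2 =
  2 * (((xd 0 0 + xs 0 0) / 2 - xc 0 0) ^+ 2 +
       ((xd 0 1 + xs 0 1) / 2 - xc 0 1) ^+ 2 + xc 0 2 ^+ 2) +
  eucl_dist xd xs ^+ 2 / 2.
Proof. by move=> d0 s0; rewrite !eucl_distE d0 s0; field. Qed.

Lemma lambda_le (xd xs yd ys : 'rV[R]_3) : (lam xd xs <= lam yd ys) =
  (eucl_dist xd xc ^+ 2 + eucl_dist xs xc ^+ 2 <=
   eucl_dist yd xc ^+ 2 + eucl_dist ys xc ^+ 2).
Proof.
have vD : 0 < 2 * v * D by rewrite !mulr_gt0.
rewrite /lambda ler_sqrt ?ler_pM2r ?invr_gt0//.
by rewrite divr_ge0 ?addr_ge0 ?sqr_ge0// ltW.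
Qed.

(** The height of [xc] above the boundary contributes a positive square. *)
Lemma lambda_gt0 (xd xs : 'rV[R]_3) : halfspace_bd xd -> 0 < lam xd xs.
Proof.
move=> d0; rewrite sqrtr_gt0 divr_gt0 ?mulr_gt0//.
rewrite ltr_wpDr ?sqr_ge0// eucl_distE d0 sub0r sqrrN.
by rewrite ltr_wpDl ?addr_ge0 ?sqr_ge0// exprn_gt0.
Qed.

Lemma tpeak_root (xd xs : 'rV[R]_3) : sd_pair v D mu_a ell xc (xd, xs) ->
  peak_root (mu_a * v) ell (lam xd xs) (tp xd xs).
Proof.
move=> [d0 _ h]; apply: xgetPex; apply: peak_root_exists h => //.
  exact: mulr_gt0.
exact: lambda_gt0.
Qed.

Lemma tpeak_le (xd xs yd ys : 'rV[R]_3) :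
  sd_pair v D mu_a ell xc (xd, xs) -> sd_pair v D mu_a ell xc (yd, ys) ->
  (tp xd xs <= tp yd ys) = (lam xd xs <= lam yd ys).
Proof.
have k0 : 0 < mu_a * v by exact: mulr_gt0.
move=> hx hy; have rx := tpeak_root _ _ hx; have ry := tpeak_root _ _ hy.
have x0 : 0 < lam xd xs by case: hx => + _ _; exact: lambda_gt0.
have y0 : 0 < lam yd ys by case: hy => + _ _; exact: lambda_gt0.
have [lxy|lyx|lE] := ltgtP (lam xd xs) (lam yd ys).
- exact/ltW/(peak_root_lt k0 hell x0 lxy rx ry).
- exact/lt_geF/(peak_root_lt k0 hell y0 lyx ry rx).
(* [tpeak] depends on the pair only through [lambda]. *)
- by rewrite /tpeak lE lexx.
Qed.

(** The standing assumption bounds [lambda] from above; this makes the centered pair an admissible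
    competitor in the minimization. *)
Lemma sd_pair_lambda_le (xd xs yd ys : 'rV[R]_3) :
  halfspace_bd xd -> halfspace_bd xs -> lam xd xs <= lam yd ys ->
  sd_pair v D mu_a ell xc (yd, ys) -> sd_pair v D mu_a ell xc (xd, xs).
Proof.
move=> xd0 xs0 l [_ _ h]; split=> //; apply: le_lt_trans h => /=.
by rewrite ler_wpM2l ?mulr_ge0 ?sqrtr_ge0 ?powR_ge0// ler_wsqrtr.
Qed.

Lemma minimizer_midpoint (xd xs : 'rV[R]_3) (r : R) :
  sd_pair v D mu_a ell xc (xd, xs) -> r = eucl_dist xd xs ->
  let S := [set p | sd_pair v D mu_a ell xc p /\ r = eucl_dist p.1 p.2] in
  let f := fun p : 'rV[R]_3 * 'rV[R]_3 => tp p.1 p.2 in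
  (exists p, is_minimizer S f p) /\
  (is_minimizer S f (xd, xs) <->
   xc 0 0 = (xd 0 0 + xs 0 0) / 2 /\ xc 0 1 = (xd 0 1 + xs 0 1) / 2).
Proof.
move=> h rE S f.
have centered_min yd ys : S (yd, ys) ->
    xc 0 0 = (yd 0 0 + ys 0 0) / 2 -> xc 0 1 = (yd 0 1 + ys 0 1) / 2 ->
    is_minimizer S f (yd, ys).
  move=> yS m0 m1; split=> [|[zd zs] [hz /= rz]]; first exact: yS.
  have [hy /= ry] := yS.
  rewrite tpeak_le// lambda_le.
  case: hy hz => yd0 ys0 _ [zd0 zs0 _].
  rewrite !dist_midpoint// -ry -rz -m0 -m1 !subrr expr0n/= !add0r.
  by rewrite lerD2r ler_pM2l// lerDr addr_ge0 ?sqr_ge0.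
(* The horizontal translation that brings the midpoint below [xc]; it preserves the boundary and the
   separation. *)
pose u : 'rV[R]_3 := \row_i
  (if i == 2 then 0 else xc 0 i - (xd 0 i + xs 0 i) / 2).
have [xd0 xs0 _] := h.
have ud0 : halfspace_bd (xd + u) by rewrite /halfspace_bd/= !mxE/= addr0.
have us0 : halfspace_bd (xs + u) by rewrite /halfspace_bd/= !mxE/= addr0.
have m0 : xc 0 0 = ((xd + u) 0 0 + (xs + u) 0 0) / 2.
  by rewrite !mxE/=; field.
have m1 : xc 0 1 = ((xd + u) 0 1 + (xs + u) 0 1) / 2.
  by rewrite !mxE/=; field.
have dE : eucl_dist (xd + u) (xs + u) = eucl_dist xd xs.
  congr Num.sqrt; apply: eq_bigr => i _.
  by rewrite !mxE; congr (_ ^+ 2); ring.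
have uS : S (xd + u, xs + u).
  split; last by rewrite /= dE.
  apply: sd_pair_lambda_le h => //.
  rewrite lambda_le !dist_midpoint// dE -m0 -m1 !subrr expr0n/= !add0r.
  by rewrite lerD2r ler_pM2l// lerDr addr_ge0 ?sqr_ge0.
split; first by exists (xd + u, xs + u); exact: centered_min.
(* Comparing a minimizer with its centered translate forces the squared horizontal offset of its
   midpoint to be at most 0. *)
split=> [[_ /(_ _ uS)]|[e0 e1]]; last exact: centered_min.
rewrite /f/= tpeak_le//; last exact: uS.1.
rewrite lambda_le !dist_midpoint// dE -m0 -m1 !subrr expr0n/= !add0r.
rewrite lerD2r ler_pM2l// gerDr => le0.
have /eqP : ((xd 0 0 + xs 0 0) / 2 - xc 0 0) ^+ 2 +
            ((xd 0 1 + xs 0 1) / 2 - xc 0 1) ^+ 2 = 0.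
  by apply: le_anti; rewrite le0 addr_ge0 ?sqr_ge0.
rewrite paddr_eq0 ?sqr_ge0// !sqrf_eq0 !subr_eq0.
by case/andP => /eqP <- /eqP <-.
Qed.

Lemma tpeak_eq_planar_dist {xd xs yd ys : 'rV[R]_3} :
  sd_pair v D mu_a ell xc (xd, xs) -> sd_pair v D mu_a ell xc (yd, ys) ->
  tp xd xs = tp yd ys ->
  (xd 0 0 - xc 0 0) ^+ 2 + (xd 0 1 - xc 0 1) ^+ 2 +
    ((xs 0 0 - xc 0 0) ^+ 2 + (xs 0 1 - xc 0 1) ^+ 2) =
  (yd 0 0 - xc 0 0) ^+ 2 + (yd 0 1 - xc 0 1) ^+ 2 +
    ((ys 0 0 - xc 0 0) ^+ 2 + (ys 0 1 - xc 0 1) ^+ 2).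
Proof.
move=> hx hy e.
have : eucl_dist xd xc ^+ 2 + eucl_dist xs xc ^+ 2 =
       eucl_dist yd xc ^+ 2 + eucl_dist ys xc ^+ 2.
  apply/eqP; rewrite eq_le -!lambda_le.
  by rewrite -(tpeak_le _ _ _ _ hx hy) -(tpeak_le _ _ _ _ hy hx) e lexx.
case: hx hy => + + _ [+ + _]; rewrite /halfspace_bd/= => xd0 xs0 yd0 ys0.
by rewrite !eucl_distE xd0 xs0 yd0 ys0 addrACA [RHS]addrACA => /addIr.
Qed.

End tpeak_lambda.

(** * Pairs translated along one axis *)

Lemma row3P (R : realType) (x y : 'rV[R]_3) :
  x 0 0 = y 0 0 -> x 0 1 = y 0 1 -> x 0 2 = y 0 2 -> x = y.
Proof.
move=> e0 e1 e2; apply/rowP => -[[|[|[|//]]] i3].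
- by rewrite (_ : Ordinal _ = 0)//; exact: val_inj.
- by rewrite (_ : Ordinal _ = 1)//; exact: val_inj.
- by rewrite (_ : Ordinal _ = 2)//; exact: val_inj.
Qed.

(** With the common shift [d1 - d2], the difference of the two sides is
    [2 * (d1 - d2) * (s1 + d2 - 2 * a)], and the shift can be cancelled. *)
Lemma translated_midpoint {R : realType} {a d1 s1 d2 s2 : R} :
  (d1 - a) ^+ 2 + (s1 - a) ^+ 2 = (d2 - a) ^+ 2 + (s2 - a) ^+ 2 ->
  s1 - s2 = d1 - d2 -> d1 != d2 -> a = (s1 + d2) / 2.
Proof.
move=> e es d12; have d0 : d1 - d2 != 0 by rewrite subr_eq0.
apply: (mulfI d0).
have s1E : s1 = s2 + (d1 - d2) by lra.
rewrite {}s1E {es} in e *; lra.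
Qed.

Theorem theorem4p2 (R : realType) (v D mu_a ell : R)
    (xc xd1 xs1 xd2 xs2 : 'rV[R]_3)
    (hv : 0 < v) (hD : 0 < D) (hmu : 0 < mu_a) (hell : 0 < ell)
    (hxc : halfspace xc)
    (h1 : sd_pair v D mu_a ell xc (xd1, xs1))
    (h2 : sd_pair v D mu_a ell xc (xd2, xs2)) :
  let t := tpeak v D mu_a ell xc in
  let lam := lambda v D xc in
  (t xd1 xs1 >= t xd2 xs2 <-> lam xd1 xs1 >= lam xd2 xs2) /\
  (eucl_dist xd1 xs1 = eucl_dist xd2 xs2 ->
   [/\ (* t attains a minimum among the pairs with this separation, and the
          minimizers are exactly the pairs with midpoint below xc *)
       let S := [set p | sd_pair v D mu_a ell xc p /\
                         eucl_dist xd1 xs1 = eucl_dist p.1 p.2] in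
       let f := fun p : 'rV[R]_3 * 'rV[R]_3 => t p.1 p.2 in
       (exists p, is_minimizer S f p) /\
       (is_minimizer S f (xd2, xs2) <->
        xc 0 0 = (xd2 0 0 + xs2 0 0) / 2 /\ xc 0 1 = (xd2 0 1 + xs2 0 1) / 2),
       (xd1, xs1) <> (xd2, xs2) ->
       xs1 0 0 - xs2 0 0 = xd1 0 0 - xd2 0 0 ->
       xs1 0 1 = xs2 0 1 -> xd1 0 1 = xd2 0 1 ->
       t xd1 xs1 = t xd2 xs2 ->
       xc 0 0 = (xs1 0 0 + xd2 0 0) / 2 &
       (xd1, xs1) <> (xd2, xs2) ->
       xs1 0 1 - xs2 0 1 = xd1 0 1 - xd2 0 1 ->
       xs1 0 0 = xs2 0 0 -> xd1 0 0 = xd2 0 0 ->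
       t xd1 xs1 = t xd2 xs2 ->
       xc 0 1 = (xs1 0 1 + xd2 0 1) / 2]).
Proof.
have [xd10 xs10 _] := h1; have [xd20 xs20 _] := h2.
move=> t lam; split; first by rewrite tpeak_le.
move=> r12; split; first exact: minimizer_midpoint.
- move=> neq es s1E d1E /(tpeak_eq_planar_dist hv hD hmu hell hxc h1 h2).
  rewrite s1E d1E addrACA [RHS]addrACA => /addIr e.
  (* A zero shift would make the two pairs coincide, against [neq]. *)
  apply: (translated_midpoint e es); apply/eqP => d0E.
  move: es; rewrite d0E subrr => /subr0_eq s0E.
  by apply: neq; congr (_, _); apply: row3P => //; rewrite ?xd10 ?xs10.
- move=> neq es s0E d0E /(tpeak_eq_planar_dist hv hD hmu hell hxc h1 h2).
  rewrite s0E d0E addrACA [RHS]addrACA => /addrI e.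
  apply: (translated_midpoint e es); apply/eqP => d1E.
  move: es; rewrite d1E subrr => /subr0_eq s1E.
  by apply: neq; congr (_, _); apply: row3P => //; rewrite ?xd10 ?xs10.
Qed.
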